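(* Let $X$ be a proper geodesic $\delta$-hyperbolic metric space, let $b \in \hat{\mathcal{B}}(X)$ with basepoint $\omega \in X \cup \partial X$, and suppose that $X$ is $K$-roughly starlike from $\omega$. Let $\varepsilon > 0$ be such that $\rho_{\varepsilon}(x) = e^{-\varepsilon b(x)}$ is a GH-density for $X$ with constant $M$. Suppose there is a cocompact discrete isometric action of a group $\Gamma$ on $X$, and let $\mu$ be a $\Gamma$-invariant Borel regular measure on $X$ that is doubling on balls of radius at most $R_{0}$ with constant $C_\mu$, where $R_0$ is large enough that for each $x\in X$ the translates of $B_X(x,R_0)$ by $\Gamma$ cover $X$. Then for each $\beta > h_{X}$ the measure $\mu_{\beta}$ on $\bar{X}_{\varepsilon}$ is doubling with doubling constant $C_{\mu_{\beta}}$ depending only on $\delta$, $K$, $\varepsilon$, $M$, $\beta$, $R_0$, $C_\mu$ and the constant $C_{h}$ with $h = (\beta+ h_{X})/2$, where $C_h \geq 1$ is a constant such that $N_{\Gamma}(x,R)\le C_he^{hR}$ for all $x\in X$ and $R>0$.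
   Context: A geodesic in a metric space $(X,d)$ is an isometric map $\gamma : I \to X$ of an interval $I \subset \mathbb{R}$; $X$ is geodesic if any two points are joined by a geodesic, and proper if closed balls are compact. A geodesic metric space is $\delta$-hyperbolic ($\delta \ge 0$) if all geodesic triangles are $\delta$-thin: each point of each edge lies within distance $\delta$ of some point on another edge. The Gromov boundary $\partial X$ is the set of geodesic rays $\gamma:[0,\infty)\to X$ modulo the equivalence of being at bounded distance; the class of $\gamma$ is its endpoint. Write $|xy|=d(x,y)$; $B_X(x,r)$ is the open ball. For a geodesic ray $\gamma$, $b_{\gamma}(x) = \lim_{t\to\infty} (d(\gamma(t),x)-t)$. $\mathcal{B}(X) = \{b_{\gamma}+s : \gamma \text{ a geodesic ray in } X,\ s\in\mathbb{R}\}$; the basepoint of $b_\gamma+s$ is the endpoint $\omega\in\partial X$ of $\gamma$. For $z \in X$, $b_{z}(x) = d(x,z)$, and $\mathcal{D}(X) = \{b_{z}+s: z\in X, s\in\mathbb{R}\}$; the basepoint of $b_z+s$ is $z$. $\hat{\mathcal{B}}(X) = \mathcal{D}(X)\cup\mathcal{B}(X)$. $X$ is $K$-roughly starlike ($K\ge 0$) from $z\in X$ if for each $x \in X$ there is a geodesic ray $\gamma:[0,\infty)\to X$ with $\gamma(0)=z$ and $\mathrm{dist}(x,\gamma)\le K$. $X$ is $K$-roughly starlike from $\omega\in\partial X$ if for each $x\in X$ there is a geodesic line $\gamma:\mathbb{R}\to X$ such that the ray $t\mapsto\gamma(-t)$, $t \ge 0$, belongs to the class $\omega$ and $\mathrm{dist}(x,\gamma)\le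 K$. For the fixed $b$ and $\varepsilon$, $\ell_{\varepsilon}(\gamma)=\int_\gamma\rho_{\varepsilon}\,ds$ for a curve $\gamma$, and $X_{\varepsilon}$ is the set $X$ with the metric $d_{\varepsilon}(x,y)=\inf\ell_{\varepsilon}(\gamma)$, the infimum over all curves $\gamma$ joining $x$ to $y$. $\bar X_{\varepsilon}$ is its completion and $\partial X_{\varepsilon}=\bar X_{\varepsilon}\setminus X_{\varepsilon}$. $\rho_{\varepsilon}$ is a GH-density with constant $M\ge1$ if for all $x,y\in X$ and each geodesic $\gamma$ of $(X,d)$ joining $x$ to $y$, $\ell_{\varepsilon}(\gamma)\le M\, d_{\varepsilon}(x,y)$. A Borel measure $\mu$ is doubling with constant $C_\mu\geq 1$ if $\mu(B(x,2r))\le C_\mu\,\mu(B(x,r))$ for all points $x$ and all $r>0$ (open balls); it is doubling on balls of radius at most $R_0$ if this holds for all $x$ and $0<r\le R_0$. For $\beta>0$, $\mu_{\beta}$ is defined by $d\mu_{\beta}(x)=e^{-\beta b(x)}d\mu(x)$ on $X$, extended to $\bar X_{\varepsilon}$ by $\mu_{\beta}(\partial X_{\varepsilon})=0$. The action of $\Gamma$ is isometric if each $g \in \Gamma$ defines an isometry of $X$, cocompact if $X=\bigcup_{g\in\Gamma}g(E)$ for some compact $E\subset X$, and discrete if for each compact $E\subset X$ the number of $g\in\Gamma$ with $g(E)\cap E\ne\emptyset$ is finite. $\mu$ is $\Gamma$-invariant if $\mu(g^{-1}(E))=\mu(E)$ for all measurable $E$ and $g\in\Gamma$. $N_\Gamma(x,R)=\#\{g\in\Gamma:|xg(x)|\le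 R\}$ and $$h_X=\limsup_{R\to\infty}\frac{\log N_\Gamma(x,R)}{R},$$ which does not depend on $x\in X$. For each $h>h_X$ a constant $C_h$ with $N_{\Gamma}(x,R)\le C_he^{hR}$ for all $x\in X$, $R>0$ exists.
   Formalization: The doubling constant may also depend on h = (β + h_X)/2, hence on h_X, not just on the number C_h; otherwise the claim fails for 3-regular trees with edge length 1+1/n, β = log 2, where h_X tends to β while the listed constants stay bounded. *)

(* Defs.v *)
From HB Require Import structures.
From mathcomp Require Import all_boot all_order all_algebra finmap.
From mathcomp Require Import all_classical all_reals all_analysis.

Set Implicit Arguments.
Unset Strict Implicit.
Unset Printing Implicit Defensive.

Import Order.TTheory GRing.Theory Num.Theory.
Import numFieldNormedType.Exports.

Local Open Scope classical_set_scope.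
Local Open Scope ring_scope.

(* Measurable types in the library are pointed, so spaces carrying a measure
   are taken pointed; the distinguished point plays no role. *)
#[short(type="pmetricType")]
HB.structure Definition PointedMetric (R : numDomainType) :=
  {T of Pointed T & Metric R T}.

#[short(type="completeMetricType")]
HB.structure Definition CompleteMetric (R : numDomainType) :=
  {T of Complete T & Metric R T}.

Section Geodesics.
Context {R : realType} {X : metricType R}.
Implicit Types (x y z : X) (gamma : R -> X) (a b : R).

(* Curves defined on an interval are total functions [R -> X] of which only the
   restriction to the interval matters. *)
Definition geodesic_on (I : interval R) gamma :=
  {in I &, forall s t, mdist (gamma s) (gamma t) = `|s - t|}.

Definition geodesic_joining a b gamma x y :=
  [/\ a <= b, geodesic_on `[a, b] gamma, gamma a = x & gamma b = y].

Definition geodesic_ray gamma := geodesic_on `[0, +oo[ gamma.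

Definition geodesic_line gamma := geodesic_on `]-oo, +oo[ gamma.

Definition dist_to_set x (A : set X) : R := inf [set mdist x y | y in A].

(* [E1], [E2], [E3] are the edges of a triangle. *)
Definition thin_triangle (delta : R) (E1 E2 E3 : set X) :=
  [/\ forall p, E1 p -> exists2 q, (E2 `|` E3) q & mdist p q <= delta,
      forall p, E2 p -> exists2 q, (E3 `|` E1) q & mdist p q <= delta &
      forall p, E3 p -> exists2 q, (E1 `|` E2) q & mdist p q <= delta].

Definition asymptotic gamma gamma' :=
  exists C : R, forall t, 0 <= t -> mdist (gamma t) (gamma' t) <= C.

Definition ray_class gamma : set (R -> X) :=
  [set gamma' | geodesic_ray gamma' /\ asymptotic gamma gamma'].

Definition busemann gamma x : R :=
  lim (mdist (gamma t) x - t @[t --> +oo]).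

Definition curve_length gamma a b : \bar R :=
  ereal_sup [set (\sum_(0 <= i < size s)
      mdist (gamma (nth b (a :: s) i)) (gamma (nth b (a :: s) i.+1)))%:E
    | s in itv_partition a b].

(* The value at [t] of the arc length parametrization of [gamma] on [a, b]:
   the image of the first parameter at which the length reaches [t]. *)
Definition arclength_param gamma a b (t : R) : X :=
  gamma (inf [set u | a <= u <= b /\ (t%:E <= curve_length gamma a u)%E]).

(* The line integral of [rho] along [gamma] on [a, b], by arc length; it is
   infinite, by convention, along non-rectifiable curves. *)
Definition curve_integral (rho : X -> R) gamma a b : \bar R :=
  if curve_length gamma a b is L%:E then
    (\int[lebesgue_measure]_(t in `[0%R, L]) (rho (arclength_param gamma a b t))%:E)%E
  else +oo%E.

Definition conformal_dist (rho : X -> R) x y : \bar R :=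
  ereal_inf [set l | exists gamma a b,
    [/\ a <= b, {within `[a, b], continuous gamma},
        gamma a = x, gamma b = y & l = curve_integral rho gamma a b]].

Definition GH_density (rho : X -> R) (M : R) :=
  forall x y gamma a b, geodesic_joining a b gamma x y ->
    (curve_integral rho gamma a b <= M%:E * conformal_dist rho x y)%E.

End Geodesics.

Section Spaces.
Context {R : realType}.
Variable X : metricType R.

Definition proper_space :=
  forall (x : X) (r : R), compact [set y : X | mdist x y <= r].

Definition geodesic_space :=
  forall x y : X, exists gamma a b, geodesic_joining a b gamma x y.

Definition hyperbolic_space (delta : R) :=
  forall (x y z : X) g1 g2 g3 a1 b1 a2 b2 a3 b3,
    geodesic_joining a1 b1 g1 x y ->
    geodesic_joining a2 b2 g2 y z ->
    geodesic_joining a3 b3 g3 z x ->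
    thin_triangle delta (g1 @` `[a1, b1]) (g2 @` `[a2, b2]) (g3 @` `[a3, b3]).

Definition gromov_boundary :=
  {c : set (R -> X) | exists2 gamma, geodesic_ray gamma & c = ray_class gamma}.

(* [b] belongs to D(X) (for [omega] in X) or to B(X) (for [omega] in the Gromov
   boundary), with basepoint [omega]. *)
Definition busemann_with_basepoint (b : X -> R) (omega : X + gromov_boundary) :=
  match omega with
  | inl z => exists s : R, forall x, b x = mdist x z + s
  | inr xi => exists gamma, exists s : R,
      [/\ geodesic_ray gamma, sval xi = ray_class gamma &
          forall x, b x = busemann gamma x + s]
  end.

Definition roughly_starlike (K : R) (omega : X + gromov_boundary) :=
  match omega with
  | inl z => forall x : X, exists gamma,
      [/\ geodesic_ray gamma, gamma 0 = z &
          dist_to_set x (gamma @` `[0, +oo[) <= K]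
  | inr xi => forall x : X, exists gamma,
      [/\ geodesic_line gamma, sval xi (fun t => gamma (- t)) &
          dist_to_set x (range gamma) <= K]
  end.

End Spaces.

(* [iota] exhibits [Y] as the completion of [X] endowed with the metric [d]. *)
Definition is_completion {R : realType} {X : metricType R}
    (d : X -> X -> \bar R) {Y : completeMetricType R} (iota : X -> Y) :=
  (forall x y, (mdist (iota x) (iota y))%:E = d x y) /\ dense (range iota).

Definition doubling_upto {R : realType} {T : metricType R} (mu : set T -> \bar R)
    (R0 C : R) :=
  1 <= C /\ forall (x : T) (r : R), 0 < r -> r <= R0 ->
    (mu (ball x (2 * r)) <= C%:E * mu (ball x r))%E.

Definition doubling {R : realType} {T : metricType R} (mu : set T -> \bar R)
    (C : R) :=
  1 <= C /\ forall (x : T) (r : R), 0 < r ->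
    (mu (ball x (2 * r)) <= C%:E * mu (ball x r))%E.

Section Measures.
Context {R : realType} {X : pmetricType R}.

(* A Borel regular measure is an outer measure for which Borel sets are
   measurable and every set has a Borel hull of the same measure. *)
Definition borel_regular (mu : {outer_measure set X -> \bar R}) :=
  (forall A, <<s @open X >> A -> mu.-caratheodory A) /\
  (forall A : set X, exists B, [/\ <<s @open X >> B, A `<=` B & mu B = mu A]).

Definition weighted_measure (mu : {outer_measure set X -> \bar R})
    (beta : R) (b : X -> R) (A : set X) : \bar R :=
  (\int[(mu : {measure set (caratheodory_type mu) -> \bar R})]_(x in A)
     (expR (- beta * b x))%:E)%E.

(* The extension by zero to the completion. *)
Definition weighted_measure_completion (mu : {outer_measure set X -> \bar R})
    (beta : R) (b : X -> R) {Y : completeMetricType R} (iota : X -> Y)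
    (A : set Y) : \bar R :=
  weighted_measure mu beta b (iota @^-1` A).

End Measures.

Section Actions.
Context {R : realType} {X : metricType R} {G : groupType}.
Variable act : G -> X -> X.

Definition group_action :=
  (forall x, act 1%g x = x) /\
  (forall g h x, act (g * h)%g x = act g (act h x)).

Definition isometric_action :=
  forall g x y, mdist (act g x) (act g y) = mdist x y.

Definition cocompact_action :=
  exists2 E : set X, compact E & \bigcup_(g in [set: G]) (act g @` E) = [set: X].

Definition discrete_action :=
  forall E : set X, compact E ->
    finite_set [set g | (act g @` E) `&` E !=set0].

Definition invariant_measure (mu : {outer_measure set X -> \bar R}) :=
  forall g (E : set X), mu.-caratheodory E -> mu (act g @^-1` E) = mu E.

(* [fset_set] is [fset0] on infinite sets, which do not occur here when the
   action is discrete and [X] is proper. *)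
Definition orbit_count (x : X) (r : R) : nat :=
  #|` fset_set [set g | mdist x (act g x) <= r] |.

Definition orbit_growth (x : X) : \bar R :=
  limf_esup (fun r : R => (ln (orbit_count x r)%:R / r)%:E) +oo.

End Actions.

(* Main.v *)
Require Import Defs.
From mathcomp Require Import all_boot all_order all_algebra finmap lra ring.
From mathcomp Require Import all_classical all_reals all_analysis.
From mathcomp Require Import measurable_realfun.
Import Order.TTheory GRing.Theory Num.Theory.
Import numFieldNormedType.Exports.
Local Open Scope classical_set_scope.
Local Open Scope ring_scope.

Set Implicit Arguments.
Unset Strict Implicit.

(** Write [rho x = expR (- eps * b x)] and let [A x r] be the trace on [X] of
    the ball of radius [r] centred at [x] for the conformal distance [e]. Two
    facts drive the proof.

    Along a geodesic of length [L] from [x] to [y], the function [b] is, up to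
    an additive [2 * delta], the V-shaped function [max (b x - t) (b y - (L - t))]
    ([distance_roughly_V_shaped], [busemann_roughly_V_shaped]): for a distance
    function this is thinness of triangles, and it passes to the limit for a
    Busemann function. Since [rho] is a GH-density, the integral of [rho] along
    a geodesic gives [e] up to the factor [M], and integrating the exponential
    of a V shape bounds [e] in terms of [b] and of the distance of [X].

    The growth hypothesis and the invariance of [mu] bound the measure of a
    ball of radius [r] by [Ch * expR (h * (r + R0))] times that of the concentric
    ball of radius [R0] ([ball_growth]), because that many translates of the
    latter cover the former. As [h < beta], this growth is beaten by the weight
    in the shadow of a point [z], that is on a set where [b] increases away
    from [z] at unit speed up to an additive constant: the whole shadow weighs no
    more than a constant times [expR (- beta * b z) * mu (ball z R0)]
    ([weighted_measure_shadow]).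

    Doubling of [A x r] then splits according to the size of [r] with respect
    to [rho x]. If [r] is small, [A x r] and [A x (2 * r)] are comparable to
    balls of [X] of radius at most [R0] on which the weight is almost constant
    ([weighted_doubling_small]). Otherwise there is a point [z] with [rho z]
    comparable to [r] and [e x z <= r / 2], namely [x] itself, or a point
    obtained by climbing from [x] towards the basepoint, or the basepoint if it
    is reached before that height. Then [A x (2 * r)] lies in the shadow of [z],
    while [A x r] contains a ball of [X] centred at [z] of a definite radius
    ([weighted_doubling_shadow]). Balls centred at points added by the
    completion are squeezed between balls centred at points of [X]. *)

(** * Length and line integrals along geodesics *)

Section GeodesicLength.
Context {R : realType} {X : metricType R}.
Implicit Types (x y : X) (g : R -> X) (L u : R) (rho : X -> R).

Lemma geodesic_shift0 a b g x y : geodesic_joining a b g x y ->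
  geodesic_joining 0 (b - a) (fun t => g (t + a)) x y.
Proof.
case=> ab gg <- <-; split; rewrite ?subr_ge0 ?add0r ?subrK// => s t.
rewrite !in_itv/= => s0 t0; rewrite gg ?in_itv/=; [|lra|lra].
by congr `|_|; lra.
Qed.

Lemma geodesic_dist L g x y s t : geodesic_joining 0 L g x y ->
  0 <= s <= L -> 0 <= t <= L -> mdist (g s) (g t) = `|s - t|.
Proof. by case=> _ gg _ _ s0 t0; rewrite gg ?in_itv. Qed.

Lemma geodesic_length_dist L g x y : geodesic_joining 0 L g x y ->
  mdist x y = L.
Proof.
move=> gg; have [L0 _ <- <-] := gg.
by rewrite (geodesic_dist gg) ?lexx ?L0// sub0r normrN ger0_norm.
Qed.

Lemma geodesic_dist_start L g x y t : geodesic_joining 0 L g x y ->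
  0 <= t <= L -> mdist x (g t) = t.
Proof.
move=> gg t0; have [L0 _ <- _] := gg.
by rewrite (geodesic_dist gg) ?lexx ?L0// sub0r normrN ger0_norm//; lra.
Qed.

Lemma geodesic_dist_end L g x y t : geodesic_joining 0 L g x y ->
  0 <= t <= L -> mdist y (g t) = L - t.
Proof.
move=> gg t0; have [L0 _ _ <-] := gg.
by rewrite (geodesic_dist gg) ?lexx ?L0// ger0_norm//; lra.
Qed.

(** On a geodesic the sum over any partition telescopes. *)
Lemma curve_length_geodesic L g x y u : geodesic_joining 0 L g x y ->
  0 <= u <= L -> curve_length g 0 u = u%:E.
Proof.
move=> gg uL.
have sumE s : itv_partition 0 u s ->
    (\sum_(0 <= i < size s)
      mdist (g (nth u (0 :: s) i)) (g (nth u (0 :: s) i.+1))) = u.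
  move=> su; rewrite (telescope_sumr_eq (nth u (0 :: s)))//.
    by rewrite (itv_partition_nth_size _ su)/= subr0.
  move=> i /andP[_ ilt].
  have [/(pathP u)/(_ i ilt) lti _] := su.
  have h0 := itv_partition_nth_ge (ltnW ilt : (i < (size s).+1)%N) su.
  have h1 := itv_partition_nth_le (ilt : (i.+1 < (size s).+1)%N) su.
  change (nth u s i) with (nth u (0 :: s) i.+1) in lti.
  set p := nth u (0 :: s) i in h0 lti *; set q := nth u (0 :: s) i.+1 in h1 lti *.
  rewrite (geodesic_dist gg); [|lra|lra].
  by rewrite distrC ger0_norm; lra.
apply/eqP; rewrite eq_le; apply/andP; split.
  by apply: ge_ereal_sup => _ [s su <-]; rewrite sumE.
apply: ereal_sup_ubound.
have [u0|] := ltrP 0 u.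
  by exists [:: u]; [exact: itv_partition1 | rewrite sumE//; exact: itv_partition1].
move=> u0; have {u0 uL} -> : u = 0 by lra.
by exists [::] => //=; rewrite big_geq.
Qed.

Lemma arclength_param_geodesic L g x y t : geodesic_joining 0 L g x y ->
  0 <= t <= L -> arclength_param g 0 L t = g t.
Proof.
move=> gg tL; rewrite /arclength_param; congr g.
rewrite (_ : [set _ | _] = `[t, L]%classic); first by rewrite inf_itvcc; lra.
apply/seteqP; split => u /=.
  case=> uL; rewrite (curve_length_geodesic gg uL) lee_fin in_itv/=; lra.
rewrite in_itv/= => tuL; split; first lra.
by rewrite (curve_length_geodesic gg) ?lee_fin//; lra.
Qed.

(** A geodesic is its own arc length parametrization. *)
Lemma curve_integral_geodesic rho L g x y : geodesic_joining 0 L g x y ->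
  curve_integral rho g 0 L =
  (\int[lebesgue_measure]_(t in `[0%R, L]) (rho (g t))%:E)%E.
Proof.
move=> gg; have [L0 _ _ _] := gg.
rewrite /curve_integral (curve_length_geodesic gg) ?L0 ?lexx//.
apply: eq_integral => t; rewrite inE/= in_itv/= => tL.
by rewrite (arclength_param_geodesic gg).
Qed.

End GeodesicLength.

(** * Continuity along geodesics and bounds for integrals *)

Section LipschitzDensity.
Context {R : realType} {X : metricType R}.
Implicit Types (x y : X) (g : R -> X) (L u v : R).

Lemma lipschitz1_continuous (f : X -> R) :
  (forall x y, f x - f y <= mdist x y) -> continuous f.
Proof.
move=> lf x; apply/cvgrPdist_lt => e e0; near=> y.
have : mdist x y < e.
  suff : ball x e y by rewrite ballEmdist.
  by near: y; exact: nbhsx_ballx.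
apply: le_lt_trans; rewrite ler_norml lf andbT lerNl opprB.
by rewrite metric_sym lf.
Unshelve. all: by end_near. Qed.

(** A geodesic is only constrained on its interval; freezing the parameter
    outside of it gives a globally continuous curve, so that continuity and
    measurability need not be relativized. *)
Definition clamp L t : R := Num.max 0 (Num.min t L).

Lemma clamp_id L t : 0 <= t <= L -> clamp L t = t.
Proof. by move=> /andP[t0 tL]; rewrite /clamp (min_idPl tL) (max_idPr t0). Qed.

Lemma clamp_itv L t : 0 <= L -> 0 <= clamp L t <= L.
Proof. by move=> L0; rewrite /clamp le_max lexx ge_max L0 ge_min lexx orbT. Qed.

Lemma clamp_lipschitz L s t : `|clamp L s - clamp L t| <= `|s - t|.
Proof.
have := ler_norm (s - t); have := ler_norm (t - s); rewrite (distrC t s).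
rewrite ler_norml /clamp /Num.max /Num.min.
case: (ltrP s L) => ? /=; case: (ltrP t L) => ? /=;
  case: (ltrP 0 s) => ? /=; case: (ltrP 0 t) => ? /=;
  by case: (ltrP 0 L) => ? /= ? ?; apply/andP; split; lra.
Qed.

Lemma geodesic_clamp_continuous L g x y : geodesic_joining 0 L g x y ->
  continuous (g \o clamp L).
Proof.
move=> gg; have [L0 _ _ _] := gg; move=> t.
apply/metricType_numDomainType.cvgrPdist_lt => e e0; near=> s.
rewrite /= (geodesic_dist gg) ?clamp_itv//.
apply: (le_lt_trans (clamp_lipschitz _ _ _)).
by near: s; exact: (@nbhsx_ballx _ R^o).
Unshelve. all: by end_near. Qed.

Lemma geodesic_continuous L g x y : geodesic_joining 0 L g x y ->
  {within `[0, L], continuous g}.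
Proof.
move=> gg; apply: (@subspace_eq_continuous _ _ _ (g \o clamp L)).
  by move=> t; rewrite inE/= in_itv/= => tL; rewrite /= clamp_id.
exact/continuous_subspaceT/(geodesic_clamp_continuous gg).
Qed.

Lemma geodesic_density_measurable L g x y (rho : X -> R) :
  geodesic_joining 0 L g x y -> continuous rho ->
  measurable_fun `[0, L] (rho \o g).
Proof.
move=> gg crho; apply: (@eq_measurable_fun _ _ _ _ _ (rho \o (g \o clamp L))).
  by move=> t; rewrite inE/= in_itv/= => tL; rewrite /= clamp_id.
apply: measurable_funTS; apply: continuous_measurable_fun => t.
apply: continuous_comp; [exact: (geodesic_clamp_continuous gg)|exact: crho].
Qed.

End LipschitzDensity.

Section IntegralBounds.
Context {R : realType}.
Implicit Types (f : R -> R) (L u v m : R).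

Lemma integral_ge_subinterval f L u v m : measurable_fun `[0, L] f ->
  (forall t, 0 <= t <= L -> 0 <= f t) -> 0 <= u -> u <= v -> v <= L -> 0 <= m ->
  (forall t, u <= t <= v -> m <= f t) ->
  ((m * (v - u))%:E <= \int[lebesgue_measure]_(t in `[0%R, L]) (f t)%:E)%E.
Proof.
move=> mf f0 u0 uv vL m0 mle.
have sub : `[u, v] `<=` `[0, L].
  by move=> t /=; rewrite !in_itv/=; lra.
have mEf : measurable_fun `[0, L] (EFin \o f) by exact/measurable_EFinP.
apply: (@le_trans _ _ (\int[lebesgue_measure]_(t in `[u, v]) (f t)%:E)%E).
  have -> : (m * (v - u))%:E = (\int[lebesgue_measure]_(t in `[u, v]) m%:E)%E.
    rewrite integral_cst//= lebesgue_measure_itv/= lte_fin.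
    by case: ltgtP uv => // -> _; rewrite subrr mulr0 mule0.
  apply: ge0_le_integral => //.
  exact: (measurable_funS (measurable_itv _) sub mEf).
apply: ge0_subset_integral => //= t; rewrite in_itv/= lee_fin; exact: f0.
Qed.

Lemma integral_le_const f L m : measurable_fun `[0, L] f -> 0 <= L ->
  (forall t, 0 <= t <= L -> 0 <= f t <= m) ->
  (\int[lebesgue_measure]_(t in `[0%R, L]) (f t)%:E <= (m * L)%:E)%E.
Proof.
move=> mf L0 fm.
have mEf : measurable_fun `[0, L] (EFin \o f) by exact/measurable_EFinP.
have <- : (\int[lebesgue_measure]_(t in `[0%R, L]) m%:E)%E = (m * L)%:E.
  rewrite integral_cst//= lebesgue_measure_itv/= lte_fin.
  case: ltgtP L0 => // [_ _|<- _]; first by rewrite -EFinB subr0 -EFinM.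
  by rewrite mulr0 mule0.
by apply: ge0_le_integral => //= t; rewrite in_itv/= lee_fin => /fm; lra.
Qed.

(** The bound does not depend on [L], the exponential density having total
    mass [1]. *)
Lemma integral_le_exp f L eps m : measurable_fun `[0, L] f -> 0 <= L ->
  0 < eps -> 0 <= m ->
  (forall t, 0 <= t <= L -> 0 <= f t <= m * expR (- eps * t)) ->
  (\int[lebesgue_measure]_(t in `[0%R, L]) (f t)%:E <= (m / eps)%:E)%E.
Proof.
move=> mf L0 e0 m0 fm.
have mEf : measurable_fun `[0, L] (EFin \o f) by exact/measurable_EFinP.
have mp : measurable_fun [set: R] (EFin \o exponential_pdf eps).
  by apply/measurable_EFinP; exact: measurable_exponential_pdf.
have p0 t : (0 <= (exponential_pdf eps t)%:E)%E.
  by rewrite lee_fin exponential_pdf_ge0// ltW.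
have me0 : 0 <= m / eps by rewrite divr_ge0// ltW.
apply: (@le_trans _ _ (\int[lebesgue_measure]_(t in `[0%R, L])
    ((m / eps)%:E * (exponential_pdf eps t)%:E))%E).
  apply: ge0_le_integral => //=.
  - by move=> t; rewrite in_itv/= => /fm/andP[]; rewrite lee_fin.
  - by apply: measurable_funeM; exact: (measurable_funTS mp).
  - move=> t; rewrite in_itv/= => tL; rewrite lee_fin exponential_pdfE; last lra.
    rewrite mulrA divfK ?gt_eqF//; by case/andP: (fm _ tL).
rewrite ge0_integralZl//; last exact: (measurable_funTS mp).
rewrite -[leRHS]mule1 lee_wpmul2l// ?lee_fin//.
rewrite -(integral_exponential_pdf e0).
exact: ge0_subset_integral.
Qed.

End IntegralBounds.

(** * The conformal distance of a GH-density *)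

Section ConformalDistance.
Context {R : realType} {X : metricType R}.

Definition lipschitz1 (b : X -> R) := forall x y, b x - b y <= mdist x y.

(** The reverse inequality, without the error term, holds for every
    [lipschitz1] function. The height of the bottom of the V is the Gromov
    product [(b x + b y - L) / 2]. *)
Definition roughly_V_shaped (delta : R) (b : X -> R) :=
  forall L g x y t, geodesic_joining 0 L g x y -> 0 <= t <= L ->
    b (g t) <= Num.max (b x - t) (b y - (L - t)) + 2 * delta.

Context (b : X -> R) (eps M : R) (e : X -> X -> R).
Context (geodX : geodesic_space X) (lipb : lipschitz1 b) (eps0 : 0 < eps).

Let rho x := expR (- eps * b x).

Context (eE : forall x y, (e x y)%:E = conformal_dist rho x y)
        (GH : GH_density rho M).

Lemma geodesic_from_0 (x y : X) : exists g, geodesic_joining 0 (mdist x y) g x y.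
Proof.
have [g [a [c /geodesic_shift0 gg]]] := geodX x y.
by rewrite (geodesic_length_dist gg); exists (fun t => g (t + a)).
Qed.

Let rho_continuous : continuous rho.
Proof.
move=> x; apply: (@continuous_comp _ _ _ (fun y => - eps * b y) expR);
  last exact: continuous_expR.
by apply: cvgMr; exact: lipschitz1_continuous.
Qed.

Lemma conformal_le_integral L g x y : geodesic_joining 0 L g x y ->
  ((e x y)%:E <= \int[lebesgue_measure]_(t in `[0%R, L]) (rho (g t))%:E)%E.
Proof.
move=> gg; rewrite eE -(curve_integral_geodesic _ gg).
apply: ereal_inf_lbound; exists g, 0, L.
by have [L0 _ g0 gL] := gg; split => //; exact: (geodesic_continuous gg).
Qed.

Lemma integral_le_conformal L g x y : geodesic_joining 0 L g x y ->
  (\int[lebesgue_measure]_(t in `[0%R, L]) (rho (g t))%:E <= (M * e x y)%:E)%E.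
Proof.
by move=> gg; rewrite EFinM eE -(curve_integral_geodesic _ gg); exact: GH.
Qed.

Let rho_ge0 x : 0 <= rho x. Proof. exact: expR_ge0. Qed.

(** If [b] rises at unit speed from [q] to [x], with defect [c], the length of
    the geodesic is dominated by an exponential integral starting at [q]. *)
Lemma conformal_le_descent q x c : b q - c + mdist q x <= b x ->
  e q x <= expR (- eps * (b q - c)) / eps.
Proof.
move=> hx; have [g gg] := geodesic_from_0 q x.
rewrite -lee_fin; apply: (le_trans (conformal_le_integral gg)).
have [L0 _ _ _] := gg.
apply: integral_le_exp => //; rewrite ?expR_ge0//.
  exact: (geodesic_density_measurable gg).
move=> t tL; rewrite rho_ge0/= -expRD ler_expR -mulrDr !mulNr lerN2 ler_pM2l//.
have := lipb x (g t); rewrite (geodesic_dist_end gg)//; lra.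
Qed.

Lemma conformal_le_local x y :
  e x y <= expR (- eps * (b x - mdist x y)) * mdist x y.
Proof.
have [g gg] := geodesic_from_0 x y.
rewrite -lee_fin; apply: (le_trans (conformal_le_integral gg)).
have [L0 _ _ _] := gg.
apply: integral_le_const => //; first exact: (geodesic_density_measurable gg).
move=> t tL; rewrite rho_ge0/= ler_expR !mulNr lerN2 ler_pM2l//.
have := lipb x (g t); rewrite (geodesic_dist_start gg)//; lra.
Qed.

(** On the first unit of length of a geodesic from [x], the density stays above
    [expR (- eps * (b x + 1))]. *)
Lemma conformal_ge_local x y :
  expR (- eps * (b x + 1)) * Num.min 1 (mdist x y) <= M * e x y.
Proof.
have [g gg] := geodesic_from_0 x y; have [L0 _ _ _] := gg.
rewrite -lee_fin; apply: le_trans (integral_le_conformal gg).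
rewrite -[Num.min _ _]subr0; apply: integral_ge_subinterval => //.
- exact: (geodesic_density_measurable gg).
- by rewrite le_min ler01 L0.
- by rewrite ge_min lexx orbT.
move=> t; rewrite le_min => /andP[t0 /andP[t1 tL]].
rewrite ler_expR !mulNr lerN2 ler_pM2l//.
have := lipb (g t) x; rewrite metric_sym (geodesic_dist_start gg)//; lra.
Qed.

(** Along a unit of length of the geodesic, around the bottom of the V, the
    height [b] exceeds the Gromov product of the endpoints by at most
    [1 + 2 * delta]. *)
Lemma conformal_ge_product delta x y : roughly_V_shaped delta b ->
  1 <= mdist x y ->
  expR (- eps * ((b x + b y - mdist x y) / 2 + 1 + 2 * delta)) <= M * e x y.
Proof.
move=> Vb L1; have [g gg] := geodesic_from_0 x y; have [L0 _ _ _] := gg.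
set L := mdist x y in gg L0 L1 *.
have := lipb x y; have := lipb y x; rewrite metric_sym -/L => bxy byx.
(* the height along the geodesic is smallest near the parameter [u0] *)
pose u0 := (b x - b y + L) / 2; pose u := Num.min u0 (L - 1).
have uu0 : u <= u0 by rewrite ge_min lexx.
have uL : u <= L - 1 by rewrite ge_min lexx orbT.
have u_ge0 : 0 <= u by rewrite le_min /u0; apply/andP; split; lra.
have u0u : u0 <= u + 1.
  by rewrite /u /Num.min; case: ltrP => _; rewrite /u0; lra.
rewrite -lee_fin; apply: le_trans (integral_le_conformal gg).
rewrite -[X in X%:E]mulr1 [X in (_ * X)%:E](_ : 1 = u + 1 - u); last lra.
apply: integral_ge_subinterval => //; rewrite ?expR_ge0//; try lra.
  exact: (geodesic_density_measurable gg).
move=> t tu; rewrite ler_expR !mulNr lerN2 ler_pM2l//.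
have tL : 0 <= t <= L by lra.
apply: (le_trans (Vb _ _ _ _ _ gg tL)).
by rewrite lerD2r ge_max; move: uu0 u0u; rewrite /u0 => *; apply/andP; split; lra.
Qed.

End ConformalDistance.

(** * Geometry of Busemann and distance functions *)

Section BusemannFunctions.
Context {R : realType} {X : metricType R}.
Implicit Types (gamma : R -> X) (x y z : X).

Lemma geodesic_ray_dist gamma s t : geodesic_ray gamma -> 0 <= s -> 0 <= t ->
  mdist (gamma s) (gamma t) = `|s - t|.
Proof. by move=> rg s0 t0; apply: rg; rewrite in_itv/= andbT. Qed.

(** The function [t |-> mdist (gamma t) x - t] is nonincreasing and bounded
    below, so it decreases to the limit defining [busemann gamma x]. *)
Lemma busemann_approx gamma x eta : geodesic_ray gamma -> 0 < eta ->
  exists2 T, 0 <= T & forall t, T <= t ->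
    busemann gamma x <= mdist (gamma t) x - t <= busemann gamma x + eta.
Proof.
move=> rg eta0.
pose f t := mdist (gamma t) x - t; pose F t := - f (Num.max 0 t).
have fmono s t : 0 <= s -> s <= t -> f t <= f s.
  move=> s0 st; have := metric_triangle (gamma t) (gamma s) x.
  by rewrite (geodesic_ray_dist rg) /f ?ger0_norm; lra.
have F_ub : ubound (range F) (mdist (gamma 0) x).
  move=> _ [t _ <-]; rewrite /F /f; set u := Num.max 0 t.
  have u0 : 0 <= u by rewrite le_max lexx.
  have := metric_triangle (gamma u) x (gamma 0).
  by rewrite (geodesic_ray_dist rg) ?subr0 ?ger0_norm// (metric_sym x); lra.
have Fmono : {homo F : s t / s <= t}.
  move=> s t st; rewrite lerN2; apply: fmono; first by rewrite le_max lexx.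
  by rewrite ge_max !le_max lexx st orbT.
have cF := nondecreasing_cvgr Fmono (ex_intro _ _ F_ub).
have cf : f t @[t --> +oo] --> - sup (range F).
  apply: cvg_trans (cvgN cF); apply: near_eq_cvg.
  near=> t; rewrite /F/= opprK.
  have t0 : 0 <= t by near: t; apply: nbhs_pinfty_ge; exact: num_real.
  by rewrite (max_idPr t0).
have bE : busemann gamma x = - sup (range F) by exact: cvg_lim cf.
have /cvgrPdist_lt/(_ _ eta0)[T [_ HT]] := cf.
exists (Num.max 0 (T + 1)); first by rewrite le_max lexx.
move=> t; rewrite ge_max => /andP[t0 Tt]; apply/andP; split.
  rewrite bE lerNl; suff -> : - (mdist (gamma t) x - t) = F t.
    by apply: ub_le_sup; [exists (mdist (gamma 0) x)|exists t].
  by rewrite /F /f (max_idPr t0).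
have : T < t by lra.
by move=> /HT; rewrite -bE /f distrC => /ltr_normlW; lra.
Unshelve. all: by end_near. Qed.

Lemma busemann_lipschitz1 gamma : geodesic_ray gamma ->
  lipschitz1 (busemann gamma).
Proof.
move=> rg x y; apply/ler_addgt0Pl => eta eta0.
have [T _ HT] := busemann_approx x rg eta0.
have [T' _ HT'] := busemann_approx y rg eta0.
pose t := Num.max T T'.
have /HT : T <= t by rewrite le_max lexx.
have /HT' : T' <= t by rewrite le_max lexx orbT.
by have := metric_triangle (gamma t) y x; rewrite (metric_sym y x); lra.
Qed.

Lemma busemann_on_ray gamma s : geodesic_ray gamma -> 0 <= s ->
  busemann gamma (gamma s) = - s.
Proof.
move=> rg s0; apply/eqP; rewrite eq_le; apply/andP; split;
  apply/ler_addgt0Pl => eta eta0;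
  have [T T0 HT] := busemann_approx (gamma s) rg eta0;
  have /HT : T <= T + s by [lra];
  by rewrite (geodesic_ray_dist rg) ?ger0_norm; lra.
Qed.

Section Hyperbolic.
Context (delta : R) (geodX : geodesic_space X).
Context (hypX : hyperbolic_space X delta).

(** By thinness, a point of the edge from [x] to [y] is within [delta] of a point
    [q] of another edge; replacing it by [q] costs [delta] in the distance to
    [z] and [delta] in the distance to the endpoint [x] or [y]. *)
Lemma distance_roughly_V_shaped z : roughly_V_shaped delta (mdist z).
Proof.
move=> L g x y t gg tL.
have [g2 gg2] := geodesic_from_0 geodX y z.
have [g3 gg3] := geodesic_from_0 geodX z x.
have [thin _ _] := hypX gg gg2 gg3.
have /thin[q [] [s /=]] : (g @` `[0, L]) (g t) by exists t; rewrite ?inE/= ?in_itv.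
  rewrite in_itv/= => sL qE dq; rewrite -lerBlDr le_max; apply/orP; right.
  have := metric_triangle z q (g t); have := metric_triangle y q (g t).
  have := geodesic_dist_start gg2 sL; have := geodesic_dist_end gg2 sL.
  have := geodesic_dist_end gg tL.
  by rewrite qE (metric_sym q (g t)) (metric_sym y z); lra.
rewrite in_itv/= => sL qE dq; rewrite -lerBlDr le_max; apply/orP; left.
have := metric_triangle z q (g t); have := metric_triangle x q (g t).
have := geodesic_dist_start gg3 sL; have := geodesic_dist_end gg3 sL.
have := geodesic_dist_start gg tL.
by rewrite qE (metric_sym q (g t)); lra.
Qed.

Lemma busemann_roughly_V_shaped gamma : geodesic_ray gamma ->
  roughly_V_shaped delta (busemann gamma).
Proof.
move=> rg L g x y t gg tL; apply/ler_addgt0Pl => eta eta0.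
have [T _ HT] := busemann_approx x rg eta0.
have [T' _ HT'] := busemann_approx y rg eta0.
have [T'' _ HT''] := busemann_approx (g t) rg eta0.
pose s := Num.max T (Num.max T' T'').
have /HT : T <= s by rewrite le_max lexx.
have /HT' : T' <= s by rewrite !le_max lexx orbT.
have /HT'' : T'' <= s by rewrite !le_max lexx !orbT.
have := distance_roughly_V_shaped (gamma s) gg tL.
by rewrite /Num.max; case: ltrP => ?; case: ltrP => ?; lra.
Qed.

(** Two alternatives cover both kinds of basepoint: one can climb from [x]
    towards the basepoint by the height [t], or the basepoint is a point of
    [X] within [t] of [x]. *)
Definition climbs (b : X -> R) := forall x t, 0 <= t ->
  (exists q, mdist x q = t /\ b x - t <= b q <= b x - t + 2 * delta) \/
  (exists z, mdist x z <= t /\ forall y, b y = b z + mdist z y).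

(** Geodesics from [x] to far points of the ray serve instead of a geodesic ray
    from [x] to the end of [gamma], whose existence would require a compactness
    argument. *)
Lemma busemann_climbs gamma : 0 <= delta -> geodesic_ray gamma ->
  climbs (busemann gamma).
Proof.
move=> d0 rg x t t0; left.
(* far along [gamma] the point at distance [t] from [x] on the geodesic to
   [gamma T] still lies on the side of [x] in the V shape *)
have [T T0 HT] := busemann_approx x rg ltr01.
set c := busemann gamma x in HT *.
pose T' := T + `|c| + t.
have T'T : T <= T'.
  by rewrite /T'; have := normr_ge0 c; lra.
have [g gg] := geodesic_from_0 geodX x (gamma T').
set L := mdist _ _ in gg.
have cL : c <= L - T' <= c + 1 by rewrite /L metric_sym; exact: HT.
have tT' : t <= c + T'.
  by have := ler_norm (- c); rewrite normrN /T'; lra.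
have tL : 0 <= t <= L by lra.
exists (g t); have dq := geodesic_dist_start gg tL; split => //.
have := busemann_lipschitz1 rg x (g t); rewrite dq -/c => Hl.
apply/andP; split; first lra.
have := busemann_roughly_V_shaped rg gg tL.
rewrite busemann_on_ray//; last lra.
rewrite -/c => /le_trans; apply; rewrite lerD2r ge_max lexx/=; lra.
Qed.

Lemma busemann_with_basepoint_geometry (b : X -> R) omega : 0 <= delta ->
  busemann_with_basepoint b omega ->
  [/\ lipschitz1 b, roughly_V_shaped delta b & climbs b].
Proof.
move=> d0; have shiftV (f : X -> R) s : (forall x, b x = f x + s) ->
    roughly_V_shaped delta f -> roughly_V_shaped delta b.
  move=> bE Vf L g x y t gg tL; have := Vf L g x y t gg tL.
  by rewrite !bE /Num.max; case: ltrP => ?; case: ltrP => ?; lra.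
case: omega => [z|xi] /=.
  case=> s bE; split.
  - by move=> x y; rewrite !bE; have := metric_triangle x y z; lra.
  - apply: (shiftV (mdist z) s); last exact: distance_roughly_V_shaped.
    by move=> x; rewrite bE metric_sym.
  move=> x t t0; have [tx|xt] := lerP t (mdist x z); last first.
    right; exists z; split; first exact: ltW.
    by move=> y; rewrite !bE mdistxx metric_sym; lra.
  left; have [g gg] := geodesic_from_0 geodX x z.
  have tL : 0 <= t <= mdist x z by lra.
  exists (g t); rewrite (geodesic_dist_start gg tL); split => //.
  rewrite !bE [mdist (g t) z]metric_sym (geodesic_dist_end gg tL).
  by apply/andP; split; lra.
case=> gamma [s [rg _ bE]]; split.
- by move=> x y; rewrite !bE; have := busemann_lipschitz1 rg x y; lra.
- by apply: (shiftV _ _ bE); exact: busemann_roughly_V_shaped.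
move=> x t t0; have [[q [dq hq]]|[z [dz hz]]] := busemann_climbs d0 rg x t0.
  by left; exists q; split => //; rewrite !bE; lra.
by right; exists z; split => // y; rewrite !bE hz; lra.
Qed.

End Hyperbolic.
End BusemannFunctions.

(** * The weighted measure *)

Section OuterMeasures.
Context {R : realType} {X : pmetricType R} (mu : {outer_measure set X -> \bar R}).
Context (regmu : borel_regular mu).

Lemma open_ball_metric {T : metricType R} (x : T) r : open (ball x r).
Proof.
rewrite openE => y; rewrite ballEmdist/= => xy.
rewrite /interior -nbhs_ballE; exists (r - mdist x y) => /=.
  by rewrite subr_gt0.
move=> z /=; rewrite ballEmdist/= => yz.
by have := metric_triangle x y z; lra.
Qed.

Lemma open_caratheodory (A : set X) : open A -> mu.-caratheodory A.
Proof. by move=> oA; apply: regmu.1; exact: sub_sigma_algebra. Qed.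

Lemma outer_measure_le_size (I : eqType) (s : seq I) (F : I -> set X) (V : \bar R) :
  (forall i, i \in s -> mu (F i) <= V)%E -> (0 <= V)%E ->
  (mu (\big[setU/set0]_(i <- s) F i) <= (size s)%:R%:E * V)%E.
Proof.
move=> + V0; elim: s => [|i s IH] Fle.
  by rewrite big_nil outer_measure0 mul0e.
rewrite big_cons/= -add1n natrD EFinD ge0_muleDl// mul1e.
apply: (le_trans (outer_measureU2 _ _ _)).
apply: leeD; first by apply: Fle; rewrite mem_head.
by apply: IH => j js; apply: Fle; rewrite inE js orbT.
Qed.

Section Weighted.
Context (beta : R) (b : X -> R) (lipb : lipschitz1 b) (beta0 : 0 <= beta).

Let T : measurableType _ := caratheodory_type mu.
Let nu : {measure set T -> \bar R} := mu.
Let w (x : T) : \bar R := (expR (- beta * b x))%:E.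

Let weight_measurable (D : set T) : measurable D -> measurable_fun D w.
Proof.
move=> mD; apply: measurable_funS (measurableT) (@subsetT _ _) _.
apply/measurable_EFinP.
apply: (measurability _ (RGenOpens.measurableE R)).
move=> _ [_ [p [q ->] <-]]; rewrite setTI; apply: open_caratheodory.
apply: (@open_comp _ _ (fun x : X => expR (- beta * b x))); last exact: interval_open.
move=> x _; apply: (@continuous_comp _ _ _ (fun y => - beta * b y) expR).
  by apply: cvgMr; exact: lipschitz1_continuous.
exact: continuous_expR.
Qed.

Let w_ge0 x : (0 <= w x)%E. Proof. by rewrite lee_fin expR_ge0. Qed.

Lemma weighted_measureS (A B : set X) : open A -> open B -> A `<=` B ->
  (weighted_measure mu beta b A <= weighted_measure mu beta b B)%E.
Proof.
move=> oA oB AB; have mA := open_caratheodory oA; have mB := open_caratheodory oB.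
exact: (@ge0_subset_integral _ T _ nu _ _ mA mB w (weight_measurable mB)).
Qed.

Lemma weighted_measure_le (A : set X) c : mu.-caratheodory A ->
  (forall x, A x -> c <= b x) ->
  (weighted_measure mu beta b A <= (expR (- beta * c))%:E * mu A)%E.
Proof.
move=> mA cb; have mA' : measurable (A : set T) by [].
rewrite -[X in (_ <= X)%E](@integral_cst _ T _ nu A mA').
apply: (@ge0_le_integral _ T _ nu A mA' w) => //; first exact: weight_measurable.
by move=> x /cb cx; rewrite lee_fin ler_expR !mulNr lerN2 ler_wpM2l.
Qed.

Lemma weighted_measure_ge (A : set X) c : mu.-caratheodory A ->
  (forall x, A x -> b x <= c) ->
  ((expR (- beta * c))%:E * mu A <= weighted_measure mu beta b A)%E.
Proof.
move=> mA cb; have mA' : measurable (A : set T) by [].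
rewrite -[X in (X <= _)%E](@integral_cst _ T _ nu A mA').
apply: (@ge0_le_integral _ T _ nu A mA' (cst (expR (- beta * c))%:E)) => //.
- by move=> x _; rewrite lee_fin expR_ge0.
- exact: weight_measurable.
by move=> x /cb cx; rewrite lee_fin ler_expR !mulNr lerN2 ler_wpM2l.
Qed.

(** Cut [A] into shells of unit width around [z]: on the [n]-th shell the weight
    is at most [expR (- beta * (b z - c + n%:R))] and the measure at most
    [D * expR (h * n.+1%:R) * V], so that the contributions are dominated by a
    geometric series of ratio [expR (h - beta)]. *)
Lemma weighted_measure_shadow (A : set X) (z : X) (c D h : R) (V : \bar R) :
  open A -> (forall y, A y -> b z + mdist z y - c <= b y) ->
  (forall r : R, 0 < r -> (mu (ball z r) <= (D * expR (h * r))%:E * V)%E) ->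
  (0 <= V)%E -> 0 <= D -> h < beta ->
  (weighted_measure mu beta b A <=
   (expR (- beta * (b z - c)) * (D * expR h / (1 - expR (h - beta))))%:E * V)%E.
Proof.
move=> oA shadow growth V0 D0 hb.
pose S n := [set y : X | n%:R <= mdist z y < n.+1%:R].
pose F n := A `&` S n.
have mS n : mu.-caratheodory (S n).
  have -> : S n = ball z n.+1%:R `\` ball z n%:R.
    rewrite !ballEmdist; apply/seteqP; split => y /=.
      by case/andP => ? ?; split => //; apply/negP; rewrite -leNgt.
    case=> lt_n ge_n; apply/andP; split; last exact: lt_n.
    by rewrite leNgt; apply/negP.
  apply: caratheodory_measurable_setD; apply: open_caratheodory;
    exact: open_ball_metric.
have mF n : (measurable (F n : set T)).
  by apply: caratheodory_measurable_setI; [exact: open_caratheodory|exact: mS].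
have SU : \bigcup_n S n = [set: X].
  apply/seteqP; split => // y _; exists (Num.truncn (mdist z y)) => //=.
  by apply: truncn_itv; exact: mdist_ge0.
have AU : A = \bigcup_n F n by rewrite -setI_bigcupr SU setIT.
have tS : trivIset [set: nat] F.
  move=> i j _ _ [y [[_ /andP[iy yi]] [_ /andP[jy yj]]]].
  apply/eqP; rewrite eqn_leq -(ltnS i) -(ltnS j) -!(ltr_nat R).
  by rewrite (le_lt_trans iy)// (le_lt_trans jy).
rewrite [in leLHS]AU.
rewrite /weighted_measure (@ge0_integral_bigcup _ T _ nu F w)//; last first.
  by apply: weight_measurable; apply: (@bigcup_measurable _ T).
set q := expR (h - beta); set a := expR (- beta * (b z - c)) * (D * expR h).
have q01 : 0 < q < 1 by rewrite expR_gt0 expR_lt1 subr_lt0.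
have a0 : 0 <= a by rewrite !mulr_ge0 ?expR_ge0.
have qE n : expR (- beta * (b z - c + n%:R)) * (D * expR (h * n.+1%:R)) =
    geometric a q n.
  rewrite /geometric/= /a /q -expRM_natl -[n.+1]addn1 natrD.
  by rewrite mulrCA -expRD -!mulrA [RHS]mulrCA -!expRD; congr (_ * expR _); ring.
have step n : (\int[nu]_(x in F n) w x <= (geometric a q n)%:E * V)%E.
  apply: (@le_trans _ _ ((expR (- beta * (b z - c + n%:R)))%:E * mu (F n))%E).
    apply: (@weighted_measure_le _ _ (mF n)) => y [Ay /andP[ny _]].
    by have := shadow _ Ay; lra.
  apply: (@le_trans _ _ ((expR (- beta * (b z - c + n%:R)))%:E *
      ((D * expR (h * n.+1%:R))%:E * V))%E).
    rewrite lee_wpmul2l ?lee_fin ?expR_ge0//.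
    apply: le_trans (growth _ _); last by rewrite ltr0n.
    by apply: le_outer_measure => y [_ /andP[_ yn]]; rewrite ballEmdist.
  by rewrite muleA -EFinM qE.
apply: (@le_trans _ _ (\sum_(n <oo) ((geometric a q n)%:E * V))%E).
  by apply: lee_nneseries => // n _ _; apply: integral_ge0.
have g0 n : 0 <= geometric a q n by rewrite geometric_ge0//; lra.
apply: lime_le.
  by apply: is_cvg_nneseries => n _ _; rewrite mule_ge0// lee_fin.
apply: nearW => n; rewrite -ge0_sume_distrl; last by move=> i _; rewrite lee_fin.
rewrite sumEFin mulrA lee_wpmul2r// lee_fin.
by apply: geometric_le_lim => //; [lra|rewrite ger0_norm; lra].
Qed.
End Weighted.
End OuterMeasures.

(** * Measure of balls: growth and iterated doubling *)

Section GroupGrowth.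
Context {R : realType} {X : pmetricType R} (mu : {outer_measure set X -> \bar R}).
Context {Gamma : groupType} (act : Gamma -> X -> X) (R0 h Ch : R).
Context (regmu : borel_regular mu) (propX : proper_space X).
Context (gact : group_action act) (iact : isometric_action act).
Context (dact : discrete_action act) (invmu : invariant_measure act mu).
Context (cover : forall x : X,
  \bigcup_(g in [set: Gamma]) (act g @` ball x R0) = [set: X]).
Context (count : forall (x : X) (r : R), 0 < r ->
  (orbit_count act x r)%:R <= Ch * expR (h * r)).

Let actK g x : act g^-1%g (act g x) = x.
Proof. by have [a1 aM] := gact; rewrite -aM mulVg. Qed.

Let actVK g x : act g (act g^-1%g x) = x.
Proof. by have [a1 aM] := gact; rewrite -aM mulgV. Qed.

Lemma orbit_set_finite (x : X) (r : R) :
  finite_set [set g | mdist x (act g x) <= r].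
Proof.
have [r0|r0] := ltP r 0.
  rewrite (_ : [set _ | _] = set0); first exact: finite_set0.
  apply/seteqP; split => // g /=; rewrite leNgt => /negP; apply.
  exact: lt_le_trans r0 (mdist_ge0 _ _).
have fin := @dact _ (@propX x r).
apply: (sub_finite_set _ fin) => g xr.
exists (act g x); split; last exact: xr.
by exists x; rewrite /= ?mdistxx.
Qed.

Lemma cover_radius_gt0 : 0 < R0.
Proof.
have : (\bigcup_(g in [set: Gamma]) (act g @` ball (point : X) R0)) point.
  by rewrite cover.
case=> g _ [y]; rewrite ballEmdist /= => /(le_lt_trans (mdist_ge0 _ _)).
by [].
Qed.

(** The identity is always counted, so [Ch * expR (h * r) >= 1] for all [r]; at
    [r = Ch / - h] this would fail for negative [h]. *)
Lemma growth_exponent_ge0 : 1 <= Ch -> 0 <= h.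
Proof.
move=> Ch1; rewrite leNgt; apply/negP => h0.
have r0 : 0 < Ch / - h by rewrite divr_gt0//; lra.
have := count point r0.
rewrite (_ : h * _ = - Ch); last by field; lra.
have c1 : (1 <= orbit_count act point (Ch / - h))%N.
  rewrite /orbit_count cardfs_gt0; apply/fset0Pn; exists 1%g.
  rewrite in_fset_set; last exact: orbit_set_finite.
  apply/mem_set => /=.
  by rewrite gact.1 mdistxx ltW.
have : (1 : R) <= (orbit_count act point (Ch / - h))%:R by rewrite ler1n.
move=> /le_trans h1 /h1; rewrite expRN -ler_pdivrMr ?invr_gt0 ?expR_gt0//.
rewrite invrK mul1r; have := expR_ge1Dx Ch; lra.
Qed.

(** The translates of [ball z R0] that meet [ball z r] move [z] by at most
    [r + R0], and all have the same measure as [ball z R0]. *)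
Lemma ball_growth (z : X) (r : R) : 0 < r ->
  (mu (ball z r) <= (Ch * expR (h * (r + R0)))%:E * mu (ball z R0))%E.
Proof.
move=> r0; have R00 := cover_radius_gt0.
pose S := [set g | mdist z (act g z) <= r + R0].
have Sfin : finite_set S by exact: orbit_set_finite.
pose F g := act g @` ball z R0.
have muF g : mu (F g) = mu (ball z R0).
  have -> : F g = act g^-1%g @^-1` ball z R0.
    apply/seteqP; split => y /=; first by case=> w zw <-; rewrite actK.
    by move=> zy; exists (act g^-1%g y) => //; rewrite actVK.
  by apply: invmu; apply: open_caratheodory => //; exact: open_ball_metric.
apply: (@le_trans _ _ ((orbit_count act z (r + R0))%:R%:E * mu (ball z R0))%E);
  last by rewrite lee_wpmul2r// lee_fin count// addr_gt0.
apply: (@le_trans _ _ (mu (\big[setU/set0]_(g <- fset_set S) F g))).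
  apply: le_outer_measure; rewrite -bigcup_fset fset_setK// => y.
  rewrite ballEmdist/= => zy.
  have [g _ [w zw gwy]] : (\bigcup_(g in [set: Gamma]) F g) y by rewrite cover.
  exists g; last by exists w.
  have {}zw : mdist w z < R0 by move: zw; rewrite ballEmdist metric_sym.
  rewrite /S/= (le_trans (metric_triangle z y (act g z)))//.
  by rewrite -[X in _ + mdist X _]gwy iact; lra.
by apply: outer_measure_le_size => // g _; rewrite muF.
Qed.

End GroupGrowth.

Section IteratedDoubling.
Context {R : realType} {X : metricType R} (mu : {outer_measure set X -> \bar R}).

Lemma ball_le (x : X) (r s : R) : r <= s -> ball x r `<=` ball x s.
Proof. by rewrite !ballEmdist => rs y /= /lt_le_trans; apply. Qed.

Lemma doubling_upto_iter (R0 C : R) (x : X) n (r s : R) :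
  doubling_upto mu R0 C -> 0 < r -> r <= R0 -> r <= 2 ^+ n * s ->
  (mu (ball x r) <= (C ^+ n)%:E * mu (ball x s))%E.
Proof.
case=> C1 dbl; elim: n r => [|n IH] r r0 rR0 rs.
  by rewrite expr0 mul1e; apply/le_outer_measure/ball_le; rewrite expr0 mul1r in rs.
rewrite -[r in leLHS](@divfK _ 2)// mulrC.
apply: (@le_trans _ _ (C%:E * mu (ball x (r / 2)))%E); first by apply: dbl; lra.
rewrite exprS EFinM -muleA lee_wpmul2l//; first by rewrite lee_fin; lra.
by apply: IH; [lra|lra|rewrite ler_pdivrMr// mulrAC -exprSr].
Qed.

End IteratedDoubling.

(** * Doubling of the weighted measure *)

Section Constants.
Context {R : realType} (delta eps M beta R0 Cmu h Ch : R).

Definition dyadic_exponent (x : R) : nat := (Num.truncn x).+1.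

Lemma le_dyadic x : 0 <= x -> x <= 2 ^+ dyadic_exponent x.
Proof.
move=> /truncn_itv/andP[_ /ltW/le_trans]; apply.
by rewrite -natrX ler_nat ltnW// ltn_expl.
Qed.

(** Climbing from [x] to the height where [rho] equals [climb_ratio * r] moves by
    at most [expR (2 * delta * eps) * (climb_ratio * r) / eps = r / 4] for the
    conformal distance. *)
Definition climb_ratio := eps * expR (- (2 * delta * eps)) / 4.

(** The height reached by climbing is only controlled up to [2 * delta]. *)
Definition climb_ratio_lower := climb_ratio * expR (- (2 * delta * eps)).

(** For [r <= small_ratio * rho x], the conformal ball of radius [2 * r] at [x]
    lies in the ball of [X] of radius [Num.min 1 R0], where the weight is almost
    constant and [mu] is doubling. *)
Definition small_ratio := Num.min 1 R0 / (2 * M * expR eps).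

(** A bound for [rho z / r] at the comparison point [z], whether [z] comes from a
    climb or is the centre of the ball. *)
Definition density_ratio := climb_ratio + small_ratio^-1.

(** The defect [c] for which [A x (2 * r)] lies in the shadow
    [b z + mdist z y - c <= b y] of the comparison point. *)
Definition shadow_defect :=
  2 * (3 * M / climb_ratio_lower / eps + 1 + 2 * delta).

(** The ball of [X] of this radius at the comparison point stays inside the
    conformal ball of radius [r]. *)
Definition core_radius :=
  Num.min (Num.min 1 R0) (expR (- eps) / (2 * density_ratio)).

Definition small_constant :=
  expR (2 * beta) * Cmu ^+ dyadic_exponent (2 * M * expR (2 * eps)).

Definition shadow_constant :=
  expR (beta * (shadow_defect + 1)) *
  (Ch * expR (h * R0) * expR h / (1 - expR (h - beta))) *
  Cmu ^+ dyadic_exponent (R0 / core_radius).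

Definition point_constant :=
  Num.max 1 (Num.max small_constant shadow_constant).

End Constants.

Section DoublingAtPoints.
Context {R : realType} (delta eps M beta R0 Cmu h Ch : R).
Context (delta0 : 0 <= delta) (eps0 : 0 < eps) (M1 : 1 <= M) (R00 : 0 < R0).
Context (Ch1 : 1 <= Ch) (h0 : 0 <= h) (hbeta : h < beta).
Context {X : pmetricType R} {Y : metricType R} (b : X -> R) (iota : X -> Y).
Context (mu : {outer_measure set X -> \bar R}).
Context (geodX : geodesic_space X) (lipb : lipschitz1 b).
Context (Vb : roughly_V_shaped delta b) (climbb : climbs delta b).
Context (regmu : borel_regular mu) (dblmu : doubling_upto mu R0 Cmu).
Context (growth : forall (z : X) (r : R), 0 < r ->
  (mu (ball z r) <= (Ch * expR (h * (r + R0)))%:E * mu (ball z R0))%E).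
Let rho x := expR (- eps * b x).
Context (iotaE : forall x y,
  (mdist (iota x) (iota y))%:E = conformal_dist rho x y).
Context (GH : GH_density rho M).

Let e x y := mdist (iota x) (iota y).
Let A x r := iota @^-1` ball (iota x) r.
Let m := weighted_measure mu beta b.

Let beta0 : 0 <= beta. Proof. exact: le_trans h0 (ltW hbeta). Qed.
Let Cmu1 : 1 <= Cmu. Proof. by have [] := dblmu. Qed.
Let M0 : 0 < M. Proof. exact: lt_le_trans ltr01 M1. Qed.
Let Cmu0 : 0 <= Cmu. Proof. exact: le_trans ler01 Cmu1. Qed.
Let Ch0 : 0 <= Ch. Proof. exact: le_trans ler01 Ch1. Qed.
Let cr := climb_ratio delta eps.
Let crl := climb_ratio_lower delta eps.
Let sr := small_ratio eps M R0.
Let dr := density_ratio delta eps M R0.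
Let kr := core_radius delta eps M R0.
Let rho_gt0 x : 0 < rho x. Proof. exact: expR_gt0. Qed.
Let cr0 : 0 < cr. Proof. by rewrite !mulr_gt0 ?expR_gt0. Qed.
Let crl0 : 0 < crl. Proof. by rewrite mulr_gt0// expR_gt0. Qed.
Let sr0 : 0 < sr.
Proof. by rewrite divr_gt0// ?lt_min ?ltr01 ?R00// !mulr_gt0 ?expR_gt0. Qed.
Let dr0 : 0 < dr. Proof. by rewrite addr_gt0// invr_gt0. Qed.
Let kr0 : 0 < kr.
Proof.
by rewrite !lt_min ltr01 R00/= divr_gt0 ?expR_gt0// mulr_gt0.
Qed.

Lemma conformal_lt_ball y w s : mdist y w < s -> s <= 1 ->
  e y w < rho y * expR eps * s.
Proof.
move=> yws s1; apply: (le_lt_trans (conformal_le_local geodX lipb eps0 iotaE y w)).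
have d0 := mdist_ge0 y w.
apply: (@le_lt_trans _ _ (rho y * expR eps * mdist y w)).
  rewrite ler_wpM2r// -expRD ler_expR.
  have : eps * mdist y w <= eps * 1 by rewrite ler_pM2l//; lra.
  lra.
by rewrite ltr_pM2l// mulr_gt0 ?expR_gt0.
Qed.

Lemma preimage_ball_open (y : Y) r : open (iota @^-1` ball y r).
Proof.
rewrite openE => x /=; rewrite /A /= ballEmdist/= => xy.
pose g := r - mdist y (iota x).
have g0 : 0 < g by rewrite subr_gt0.
have q0 : 0 < rho x * expR eps by rewrite mulr_gt0 ?expR_gt0.
rewrite /interior -nbhs_ballE.
exists (Num.min 1 (g / (rho x * expR eps))) => /=.
  by rewrite lt_min ltr01 divr_gt0.
move=> w /=; rewrite ballEmdist/= => xw.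
have := conformal_lt_ball xw; rewrite ge_min lexx => /(_ isT) /lt_le_trans.
move=> /(_ g); rewrite -ler_pdivlMl// mulrC ge_min lexx orbT => /(_ isT).
by have := metric_triangle y (iota x) (iota w); rewrite /g /e; lra.
Qed.

Let A_open x r : open (A x r). Proof. exact: preimage_ball_open. Qed.

Let inA x y r : A x r y = (e x y < r).
Proof. by rewrite /A/= ballEmdist. Qed.

Let ball_caratheodory (x : X) r : mu.-caratheodory (ball x r).
Proof. by apply: open_caratheodory => //; exact: open_ball_metric. Qed.

Let m_ge0 B : (0 <= m B)%E.
Proof. by apply: integral_ge0 => x _; rewrite lee_fin expR_ge0. Qed.

(** On the ball, of radius at most [1], the weight is at least
    [expR (- beta * (b z + 1))]. *)
Lemma mu_ball_le_weighted z s (B : set X) : s <= 1 -> open B ->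
  ball z s `<=` B ->
  (mu (ball z s) <= (expR (beta * (b z + 1)))%:E * m B)%E.
Proof.
move=> s1 oB sB.
apply: (@le_trans _ _ ((expR (beta * (b z + 1)))%:E * m (ball z s))%E).
  have -> : mu (ball z s) = ((expR (beta * (b z + 1)))%:E *
      ((expR (- beta * (b z + 1)))%:E * mu (ball z s)))%E.
    by rewrite muleA -EFinM -expRD mulNr subrr expR0 mul1e.
  rewrite lee_wpmul2l ?lee_fin ?expR_ge0//.
  apply: weighted_measure_ge (ball_caratheodory _ _) _ => // x.
  rewrite ballEmdist/= => zx.
  by have := lipb x z; rewrite metric_sym; lra.
rewrite lee_wpmul2l ?lee_fin ?expR_ge0//.
by apply: weighted_measureS => //; exact: open_ball_metric.
Qed.

Lemma weighted_doubling_small x r : 0 < r -> r <= sr * rho x ->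
  (m (A x (2 * r)) <= (small_constant eps M beta Cmu)%:E * m (A x r))%E.
Proof.
move=> r0 rsmall.
pose u := r / rho x; have u0 : 0 < u by rewrite divr_gt0.
have rE : r = u * rho x by rewrite divfK// gt_eqF.
have usr : u <= sr by rewrite ler_pdivrMr.
(* [t] and [s] are the radii of balls of [X] around [A x (2 * r)] and inside
   [A x r]; their ratio does not depend on [r] *)
pose t := 2 * M * expR eps * u; pose s := expR (- eps) * u.
have ME0 : 0 < 2 * M * expR eps by rewrite !mulr_gt0 ?expR_gt0.
have tmin : t <= Num.min 1 R0.
  by move: usr; rewrite /sr /small_ratio ler_pdivlMr// mulrC.
have [t1 tR0] : t <= 1 /\ t <= R0 by move: tmin; rewrite le_min => /andP[].
have t0 : 0 < t by rewrite mulr_gt0.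
have s0 : 0 < s by rewrite mulr_gt0 ?expR_gt0.
have tsE : t = 2 * M * expR (2 * eps) * s.
  rewrite /t /s -!mulrA; congr (_ * (_ * _)).
  by rewrite mulrA -expRD; congr (expR _ * _); ring.
have s1 : s <= 1.
  apply: le_trans t1; rewrite tsE ler_peMl//; first exact: ltW.
  have : 1 <= expR (2 * eps) by rewrite -expR0 ler_expR mulr_ge0// ltW.
  by move: M1 => ? ?; rewrite -[leLHS]mulr1 ler_pM//; lra.
have outer : A x (2 * r) `<=` ball x t.
  move=> y; rewrite inA => exy; rewrite ballEmdist/=.
  have := conformal_ge_local geodX lipb eps0 iotaE GH x y.
  rewrite -/(e x y) => /le_lt_trans/(_ _)/=.
  have : M * e x y < M * (2 * r) by rewrite ltr_pM2l.
  move=> /[swap] /[apply].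
  have -> : M * (2 * r) = expR (- eps * (b x + 1)) * t.
    rewrite rE /t /rho mulrDr mulr1 expRD.
    rewrite [RHS](_ : _ = M * (2 * (u * expR (- eps * b x))) *
      (expR (- eps) * expR eps)); last by ring.
    by rewrite -expRD addNr expR0 mulr1.
  rewrite ltr_pM2l ?expR_gt0//; rewrite gt_min => /orP[|//]; lra.
have inner : ball x s `<=` A x r.
  move=> y; rewrite ballEmdist/= inA => xy.
  have := conformal_lt_ball xy s1.
  rewrite (_ : _ * s = expR (eps - eps) * r); last by rewrite expRD /s rE; ring.
  by rewrite subrr expR0 mul1r.
apply: (@le_trans _ _ (m (ball x t))).
  by apply: weighted_measureS => //; exact: open_ball_metric.
apply: (@le_trans _ _ ((expR (- beta * (b x - 1)))%:E * mu (ball x t))%E).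
  apply: weighted_measure_le (ball_caratheodory _ _) _ => // y.
  rewrite ballEmdist/= => xy.
  by have := lipb x y; lra.
pose n := dyadic_exponent (2 * M * expR (2 * eps)).
have ts : t <= 2 ^+ n * s.
  by rewrite tsE ler_pM2r// le_dyadic// !mulr_ge0 ?expR_ge0// ltW.
have := doubling_upto_iter x dblmu t0 tR0 ts => h1.
have h2 := mu_ball_le_weighted s1 (A_open x r) inner.
apply: (@le_trans _ _ ((expR (- beta * (b x - 1)))%:E *
    ((Cmu ^+ n)%:E * ((expR (beta * (b x + 1)))%:E * m (A x r))))%E).
  rewrite lee_wpmul2l ?lee_fin ?expR_ge0//; apply: (le_trans h1).
  by rewrite lee_wpmul2l// lee_fin exprn_ge0.
rewrite !muleA -!EFinM lee_wpmul2r//.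
rewrite lee_fin /small_constant -/n mulrAC -expRD.
by have -> : - beta * (b x - 1) + beta * (b x + 1) = 2 * beta by ring.
Qed.

(** A point [y] of [A x (2 * r)] satisfies [e z y < 3 * r], which is at most a
    multiple of [rho z]; by [conformal_ge_product] the bottom of the V between
    [z] and [y] is then not far below [z], so [b] rises from [z] to [y]. When [z]
    is the basepoint, the rise is exact. *)
Lemma weighted_doubling_shadow x z r : 0 < r -> e x z <= r / 2 -> rho z <= dr * r ->
  (crl * r <= rho z \/ forall y, b y = b z + mdist z y) ->
  (m (A x (2 * r)) <=
   (shadow_constant delta eps M beta R0 Cmu h Ch)%:E * m (A x r))%E.
Proof.
move=> r0 exz rz alt.
set c := shadow_defect delta eps M; set k := 3 * M / crl / eps.
have k0 : 0 <= k by rewrite !divr_ge0 ?mulr_ge0// ltW.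
have cE : c = 2 * (k + 1 + 2 * delta) by [].
have shadow y : A x (2 * r) y -> b z + mdist z y - c <= b y.
  rewrite inA => exy.
  have d0 := delta0.
  case: alt => [rz'|/(_ y)->]; last by rewrite cE; lra.
  have [L1|L1] := lerP 1 (mdist z y); last by have := lipb z y; rewrite cE; lra.
  have ezy : e z y < 3 * r.
    have := metric_triangle (iota z) (iota x) (iota y).
    by rewrite (metric_sym (iota z) (iota x)) -/(e x z) -/(e x y) -/(e z y); lra.
  have := conformal_ge_product geodX lipb eps0 iotaE GH Vb L1.
  rewrite -/(e z y) => lower.
  have upper : M * e z y <= expR (- eps * (b z - k)).
    have -> : - eps * (b z - k) = - eps * b z + eps * k by ring.
    rewrite expRD -/(rho z).
    (* [k] was chosen so that this follows from [1 + x <= expR x] *)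
    have ek : 3 * M / crl <= expR (eps * k).
      have -> : eps * k = 3 * M / crl by rewrite /k mulrC divfK ?gt_eqF.
      by apply: le_trans (expR_ge1Dx _); lra.
    apply: (@le_trans _ _ (rho z * (3 * M / crl))); last by rewrite ler_pM2l.
    apply: (@le_trans _ _ (M * (3 * r))); first by rewrite ler_pM2l// ltW.
    rewrite [leRHS](_ : _ = M * (3 * (rho z / crl))); last by ring.
    by rewrite ler_pM2l// ler_pM2l// ler_pdivlMr// mulrC.
  have := le_trans lower upper; rewrite ler_expR !mulNr lerN2 ler_pM2l//.
  by rewrite cE; lra.
have kr1 : kr <= 1 by rewrite !ge_min lexx.
have inner : ball z kr `<=` A x r.
  move=> y; rewrite ballEmdist/= inA => zy.
  have := conformal_lt_ball zy kr1.
  have krE : kr <= expR (- eps) / (2 * dr) by rewrite ge_min lexx orbT.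
  have : rho z * expR eps * kr <= r / 2.
    apply: (@le_trans _ _ (dr * r * expR eps * (expR (- eps) / (2 * dr)))).
      rewrite ler_pM//; [|exact: ltW|by rewrite ler_pM2r ?expR_gt0].
      by rewrite mulr_ge0 ?expR_ge0.
    rewrite expRN le_eqVlt; apply/orP; left; apply/eqP; field.
    by rewrite !gt_eqF ?expR_gt0.
  by have := metric_triangle (iota x) (iota z) (iota y);
     rewrite -/(e x z) -/(e x y) -/(e z y); lra.
pose n := dyadic_exponent (R0 / kr).
have R0n : R0 <= 2 ^+ n * kr.
  by rewrite -ler_pdivrMr// le_dyadic// divr_ge0// ltW.
have h1 := doubling_upto_iter z dblmu R00 (lexx R0) R0n.
have h2 := mu_ball_le_weighted kr1 (A_open x r) inner.
have D0 : 0 <= Ch * expR (h * R0) by rewrite mulr_ge0 ?expR_ge0.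
have growth' s : 0 < s ->
    (mu (ball z s) <= (Ch * expR (h * R0) * expR (h * s))%:E * mu (ball z R0))%E.
  by move=> /(growth z); rewrite mulrDr expRD mulrA mulrAC.
have := weighted_measure_shadow regmu lipb beta0 (A_open x (2 * r)) shadow growth'
  (outer_measure_ge0 mu _) D0 hbeta.
move=> /le_trans; apply.
set G := Ch * _ * _ / _.
have G0 : 0 <= G.
  by rewrite divr_ge0 ?mulr_ge0 ?expR_ge0// subr_ge0 ltW// expR_lt1 subr_lt0.
apply: (@le_trans _ _ ((expR (- beta * (b z - c)) * G)%:E *
    ((Cmu ^+ n)%:E * ((expR (beta * (b z + 1)))%:E * m (A x r))))%E).
  apply: lee_wpmul2l; first by rewrite lee_fin mulr_ge0 ?expR_ge0.
  apply: (le_trans h1).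
  by rewrite lee_wpmul2l// lee_fin exprn_ge0.
rewrite !muleA -!EFinM lee_wpmul2r//.
rewrite lee_fin /shadow_constant -/n -/c -/G.
rewrite [leLHS](_ : _ = expR (- beta * (b z - c)) * expR (beta * (b z + 1)) * G *
  Cmu ^+ n); last by ring.
rewrite -expRD.
by have -> : - beta * (b z - c) + beta * (b z + 1) = beta * (c + 1) by ring.
Qed.

(** Large radii are handled by the choice of the comparison point: the centre
    while [rho x] is at least [climb_ratio * r], and otherwise the result of
    climbing from [x] to the height [v] where [rho] equals [climb_ratio * r]. *)
Lemma weighted_doubling_at_point x r : 0 < r ->
  (m (A x (2 * r)) <=
   (point_constant delta eps M beta R0 Cmu h Ch)%:E * m (A x r))%E.
Proof.
move=> r0.
have [rs|rs] := lerP r (sr * rho x).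
  apply: (le_trans (weighted_doubling_small r0 rs)).
  by rewrite lee_wpmul2r// lee_fin !le_max lexx orbT.
suff [z [exz rz alt]] : exists z, [/\ e x z <= r / 2, rho z <= dr * r &
    crl * r <= rho z \/ forall y, b y = b z + mdist z y].
  apply: (le_trans (weighted_doubling_shadow r0 exz rz alt)).
  by rewrite lee_wpmul2r// lee_fin !le_max lexx !orbT.
have crl_cr : crl <= cr by rewrite ger_pMr// -expR0 ler_expR oppr_le0 !mulr_ge0// ltW.
have crdr : cr * r <= dr * r by rewrite ler_pM2r// lerDl invr_ge0 ltW.
have [xr|xr] := lerP (cr * r) (rho x).
  exists x; split.
  - by rewrite /e mdistxx divr_ge0// ltW.
  - rewrite mulrDl (le_trans _ (_ : sr^-1 * r <= _))// ?lerDr ?mulr_ge0// ?ltW//.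
    by rewrite ltr_pdivlMl.
  by left; apply: le_trans xr; rewrite ler_pM2r.
pose v := - (ln (cr * r) / eps).
have rhov : expR (- eps * v) = cr * r.
  have -> : - eps * v = ln (cr * r) by rewrite /v; field; rewrite gt_eqF.
  by rewrite lnK// posrE mulr_gt0.
have vx : v <= b x.
  by move: xr; rewrite -rhov ltr_expR !mulNr ltrN2 ltr_pM2l// => /ltW.
have e_le z : v <= b z -> b z - 2 * delta + mdist z x <= b x -> e x z <= r / 2.
  move=> vz zx; rewrite /e metric_sym.
  apply: (le_trans (conformal_le_descent geodX lipb eps0 iotaE zx)).
  apply: (@le_trans _ _ (cr * r * expR (2 * delta * eps) / eps)).
    rewrite ler_pM2r ?invr_gt0// -rhov -expRD ler_expR.
    have : eps * v <= eps * b z by rewrite ler_pM2l.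
    lra.
  rewrite /cr /climb_ratio expRN.
  rewrite [leLHS](_ : _ = r / 4); last by field; rewrite !gt_eqF ?expR_gt0.
  lra.
have rho_le z : v <= b z -> rho z <= dr * r.
  move=> vz; apply: le_trans crdr; rewrite -rhov ler_expR !mulNr lerN2.
  by rewrite ler_pM2l.
have [|[q [xq /andP[lq uq]]]|[z [xz bz]]] := @climbb x (b x - v).
- by rewrite subr_ge0.
- exists q; split; [apply: e_le|apply: rho_le|left]; rewrite ?(metric_sym q x); try lra.
  rewrite /crl /climb_ratio_lower -/cr mulrAC -rhov -expRD ler_expR.
  have : eps * b q <= eps * (v + 2 * delta) by rewrite ler_pM2l//; lra.
  lra.
- have := bz x; rewrite (metric_sym z) => bx; have d0 := delta0.
  by exists z; split; [apply: e_le|apply: rho_le|right]; rewrite ?(metric_sym z x); try lra.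
Qed.

(** Choose a point of [X] within [r / 4] of the centre: the ball of radius
    [2 * r] lies in the ball of radius [3 * r] at that point, the ball of radius
    [r] contains the ball of radius [3 / 4 * r], and two doublings lead from one
    radius to the other. *)
Lemma weighted_doubling_completion : dense (range iota) ->
  doubling (fun B : set Y => m (iota @^-1` B))
    (point_constant delta eps M beta R0 Cmu h Ch ^+ 2).
Proof.
set C := point_constant _ _ _ _ _ _ _ _ => dY.
have C1 : 1 <= C by rewrite le_max lexx.
split=> [|y r r0]; first exact: exprn_ege1.
have [z [yz [x _ xE]]] : exists w, (ball y (r / 4) `&` range iota) w.
  apply: dY; last exact: open_ball_metric.
  by exists y; rewrite ballEmdist/= mdistxx divr_gt0.
move: yz; rewrite -xE ballEmdist/= => yx.
have sub_r : A x (3 / 4 * r) `<=` iota @^-1` ball y r.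
  move=> w; rewrite /A/= !ballEmdist/= => xw.
  by have := metric_triangle y (iota x) (iota w); lra.
have sub_2r : iota @^-1` ball y (2 * r) `<=` A x (2 * (2 * (3 / 4 * r))).
  move=> w; rewrite /A/= !ballEmdist/= => yw.
  by have := metric_triangle (iota x) y (iota w); rewrite (metric_sym (iota x) y); lra.
have mS D E : open D -> open E -> D `<=` E -> (m D <= m E)%E.
  exact: weighted_measureS.
apply: (le_trans (mS _ _ (preimage_ball_open _ _) (A_open _ _) sub_2r)).
apply: (@le_trans _ _ ((C ^+ 2)%:E * m (A x (3 / 4 * r)))%E); last first.
  rewrite lee_wpmul2l ?lee_fin ?exprn_ge0//; first lra.
  exact: (mS _ _ (A_open _ _) (preimage_ball_open _ _) sub_r).
apply: (le_trans (weighted_doubling_at_point x _)); first lra.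
rewrite -/C expr2 EFinM -muleA lee_wpmul2l//; first by rewrite lee_fin; lra.
by apply: weighted_doubling_at_point; lra.
Qed.

End DoublingAtPoints.

Theorem proposition3p9 (R : realType)
    (delta K eps M beta R0 Cmu h Ch : R) :
  0 <= delta -> 0 <= K -> 0 < eps -> 1 <= M -> 1 <= Ch ->
  exists C : R,
  forall (X : pmetricType R) (b : X -> R) (omega : X + gromov_boundary X)
         (Gamma : groupType) (act : Gamma -> X -> X)
         (mu : {outer_measure set X -> \bar R}) (x0 : X) (hX : R)
         (Y : completeMetricType R) (iota : X -> Y),
  proper_space X -> geodesic_space X -> hyperbolic_space X delta ->
  busemann_with_basepoint b omega ->
  roughly_starlike K omega ->
  GH_density (fun x => expR (- eps * b x)) M ->
  group_action act -> isometric_action act ->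
  cocompact_action act -> discrete_action act ->
  borel_regular mu -> invariant_measure act mu ->
  doubling_upto mu R0 Cmu ->
  (forall x : X,
     \bigcup_(g in [set: Gamma]) (act g @` ball x R0) = [set: X]) ->
  orbit_growth act x0 = hX%:E ->
  hX < beta ->
  h = (beta + hX) / 2 ->
  (forall (x : X) (r : R), 0 < r ->
     (orbit_count act x r)%:R <= Ch * expR (h * r)) ->
  is_completion (conformal_dist (fun x => expR (- eps * b x))) iota ->
  doubling (weighted_measure_completion mu beta b iota) C.
Proof.
move=> delta0 _ eps0 M1 Ch1.
exists (point_constant delta eps M beta R0 Cmu h Ch ^+ 2).
move=> X b omega Gamma act mu x0 hX Y iota propX geodX hypX bomega _ GH
  gact iact _ dact regmu invmu dblmu cover _ hXbeta hE count [iotaE dY].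
have R00 := cover_radius_gt0 cover.
have h0 := growth_exponent_ge0 propX gact dact count Ch1.
have hbeta : h < beta by rewrite hE; lra.
have [lipb Vb climbb] := busemann_with_basepoint_geometry geodX hypX delta0 bomega.
have growth := ball_growth regmu propX gact iact dact invmu cover count.
exact: (weighted_doubling_completion delta0 eps0 M1 R00 Ch1 h0 hbeta geodX lipb Vb climbb
  regmu dblmu growth iotaE GH dY).
Qed.
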